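(* Let $R$ be a Rickart $*$-ring, let $P$ be its set of projections, and let $x$ be any element of $R$. Let $[0,x]=\{a\in R : a\mathrel{{\preceq}{*}} x\}$ and $[0,x'']=\{e\in P : e\le x''\}$. The mappings $\phi\colon [0,x]\to P$ and $\psi_x\colon [0,x'']\to R$ defined by \[ \phi(a) := a'', \qquad \psi_x(e) := xe, \] are mutually inverse and establish an order isomorphism between the initial segment $[0,x]$ of $(R,{\preceq}{*})$ and the initial segment $[0,x'']$ of $(P,\le)$.
   Context: Rings are associative. A projection of an involution ring is a self-adjoint idempotent. A Rickart $*$-ring is a ring with involution in which the left and the right annihilator of every element is a principal (left, resp. right) ideal generated by a projection; such a ring is unital. For every $x$ there is a unique projection $x'$ such that for all $z$: $xz=0$ iff $x'z=z$; one writes $x''=(x')'=1-x'$. Projections are ordered by $e\le f$ iff $ef=e=fe$; under this order the set $P$ of projections is an orthomodular lattice. The right star partial order on $R$ is defined by $a\mathrel{{\preceq}{*}} b$ iff $ba''=a=ab''$; the element $0$ is its least element. *)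

(* Defs.v *)
From HB Require Import structures.
From mathcomp Require Import all_boot all_order all_algebra.
From mathcomp Require Import boolp classical_sets.

Set Implicit Arguments.
Unset Strict Implicit.
Unset Printing Implicit Defensive.

Import GRing.Theory.

Local Open Scope classical_set_scope.
Local Open Scope ring_scope.

(* The base is pzRingType, so that the zero ring is not excluded; an identity
   is no restriction, since a Rickart *-ring always has one. *)
HB.mixin Record PzRing_isStarRing R of GRing.PzRing R := {
  star : R -> R;
  starK : involutive star;
  starD : {morph star : x y / x + y};
  starM : forall x y : R, star (x * y) = star y * star x
}.

#[short(type="starRingType")]
HB.structure Definition StarRing := {R of PzRing_isStarRing R & GRing.PzRing R}.

Definition is_proj (R : starRingType) (e : R) : bool :=
  (star e == e) && (e * e == e).

HB.mixin Record StarRing_isRickart R of StarRing R := {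
  rann_proj : forall x : R, exists2 e : R,
    is_proj e & [set z | x * z = 0] = range (fun y => e * y);
  lann_proj : forall x : R, exists2 e : R,
    is_proj e & [set z | z * x = 0] = range (fun y => y * e)
}.

#[short(type="rickartStarRingType")]
HB.structure Definition RickartStarRing :=
  {R of StarRing_isRickart R & StarRing R}.

Section RickartTheory.
Variable R : rickartStarRingType.
Implicit Types x y z a b e f : R.

Definition is_prime_of x e : Prop :=
  is_proj e /\ forall z, x * z = 0 <-> e * z = z.

Lemma is_prime_of_ex x : exists e, is_prime_of x e.
Proof.
have [e eP annE] := rann_proj x; exists e; split=> // z.
have /andP[_ /eqP ee] := eP.
split=> [xz0|<-].
  have : [set z | x * z = 0] z by [].
  by rewrite annE => -[y _ <-]; rewrite mulrA ee.
have : range (fun y => e * y) (e * z) by exists z.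
by rewrite -annE.
Qed.

Lemma is_prime_of_uniq x e f : is_prime_of x e -> is_prime_of x f -> e = f.
Proof.
move=> [/andP[/eqP es /eqP ee] eP] [/andP[/eqP fs /eqP ff] fP].
have ef : e * f = f by apply/eP/fP.
have fe : f * e = e by apply/fP/eP.
by rewrite -es -[in LHS]fe starM es fs ef.
Qed.

(* x' *)
Definition prime x : R := xget 0 [set e | is_prime_of x e].

Lemma primeP x : is_prime_of x (prime x).
Proof. exact: (xgetPex 0 (is_prime_of_ex x)). Qed.

(* x'' *)
Definition dprime x : R := prime (prime x).

Lemma dprimeE x : dprime x = 1 - prime x.
Proof.
apply: (is_prime_of_uniq (primeP _)).
have [/andP[/eqP ps /eqP pp] _] := primeP x; move: (prime x) ps pp => p ps pp.
have s0 : star 0 = 0 :> R by apply: (addrI (star 0)); rewrite -starD !addr0.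
have s1 : star 1 = 1 :> R.
  by rewrite -[RHS]starK -[in RHS](mulr1 (star 1)) starM starK mulr1.
have sN y : star (- y) = - star y.
  by apply: (addrI (star y)); rewrite -starD !subrr s0.
split=> [|z].
  apply/andP; split; apply/eqP; first by rewrite starD sN s1 ps.
  by rewrite mulrBl mul1r mulrBr mulr1 pp subrr subr0.
rewrite mulrBl mul1r; split=> [->|/eqP]; first by rewrite subr0.
by rewrite -subr_eq0 addrAC subrr sub0r oppr_eq0 => /eqP.
Qed.

Definition le_proj : rel R := fun e f => (e * f == e) && (e == f * e).

Definition le_rstar : rel R :=
  fun a b => (b * dprime a == a) && (a == a * dprime b).

Definition rstar_seg x : {pred R} := [pred a | le_rstar a x].

Definition proj_seg e0 : {pred R} := [pred e | is_proj e && le_proj e e0].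

Definition phi a : R := dprime a.

Definition psi x e : R := x * e.

End RickartTheory.

(* Main.v *)
(** For all [y] and [z] one has [y z = 0 <-> y'' z = 0], and [y''] is the only
    projection with this property. If [e <= x''], then [x e z = 0] iff
    [x'' e z = e z = 0], so [(x e)'' = e]; conversely, [a] below [x] means in
    particular [x a'' = a]. For [a], [b] below [x], both orders reduce to
    [a b'' = a], since then [b a'' = x b'' a'' = x a'' = a]. *)
Require Import Defs.
From mathcomp Require Import all_boot all_order all_algebra.

Import GRing.Theory.

Local Open Scope ring_scope.

Section DoublePrime.
Variable R : rickartStarRingType.
Implicit Types x y z a b e f : R.

Lemma dprime_eq0 y z : y * z = 0 <-> dprime y * z = 0.
Proof.
have [_ ->] := Defs.primeP y; rewrite dprimeE mulrBl mul1r.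
by split=> [->|/eqP]; [rewrite subrr | rewrite subr_eq0 => /eqP].
Qed.

Lemma dprime_proj y : is_proj (dprime y).
Proof. by have [] := Defs.primeP (Defs.prime y). Qed.

(** Turns a fixing equation into an annihilation equation, so that comparisons of right annihilators
    apply to it. *)
Lemma mulr_fixE y z : y * z = y <-> y * (z - 1) = 0.
Proof.
rewrite mulrBr mulr1.
by split=> [->|/eqP]; [rewrite subrr | rewrite subr_eq0 => /eqP].
Qed.

(** [y] and [y''] have the same right annihilator; test it on [z - 1]. *)
Lemma mul_dprime_id y z : y * z = y <-> dprime y * z = dprime y.
Proof. by rewrite !mulr_fixE; exact: dprime_eq0. Qed.

Lemma mulr_dprime y : y * dprime y = y.
Proof. by apply/(mul_dprime_id y); case/andP: (dprime_proj y) => _ /eqP. Qed.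

Lemma proj_mulC_id e f : is_proj e -> is_proj f -> e * f = e -> f * e = e.
Proof.
by move=> /andP[/eqP es _] /andP[/eqP fs _] /(congr1 star); rewrite starM es fs.
Qed.

Lemma le_projE e f : is_proj e -> is_proj f -> le_proj e f = (e * f == e).
Proof.
move=> eP fP; rewrite /le_proj; have [ef|//] := eqVneq (e * f) e.
by rewrite (proj_mulC_id _ _ eP fP ef) eqxx.
Qed.

(** Testing the hypothesis on [y'' - 1] and on [f - 1] gives [f y'' = f] and [y'' f = y'']; the
    involution turns the latter into [f y'' = y'']. *)
Lemma dprime_unique y f :
  is_proj f -> (forall z, y * z = 0 <-> f * z = 0) -> dprime y = f.
Proof.
move=> fP yf; have yP := dprime_proj y.
have fy : f * dprime y = f by apply/mulr_fixE/yf/mulr_fixE/mulr_dprime.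
have yyf : dprime y * f = dprime y.
  by apply/(mul_dprime_id y)/mulr_fixE/yf/mulr_fixE; case/andP: fP => _ /eqP.
by rewrite -(proj_mulC_id _ _ yP fP yyf) fy.
Qed.

Lemma phi_seg x a : a \in rstar_seg x -> phi a \in proj_seg (dprime x).
Proof.
rewrite !inE => /andP[_ /eqP ax].
by rewrite dprime_proj le_projE ?dprime_proj //=; apply/eqP/(mul_dprime_id a)/esym.
Qed.

Lemma phiK x : {in rstar_seg x, cancel (@phi R) (psi x)}.
Proof. by move=> a; rewrite inE => /andP[/eqP]. Qed.

Lemma psiK x : {in proj_seg (dprime x), cancel (psi x) (@phi R)}.
Proof.
move=> e; rewrite inE => /andP[eP /andP[_ /eqP xe]].
apply: dprime_unique => // z.
by rewrite /psi -mulrA dprime_eq0 mulrA -xe.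
Qed.

Lemma psi_seg x e : e \in proj_seg (dprime x) -> psi x e \in rstar_seg x.
Proof.
(* Once [(x e)'' = e] is known, the first condition is trivial and the second follows from
   [e x'' = e]. *)
move=> eS; have := psiK _ _ eS; rewrite /phi => xeE.
move: eS; rewrite !inE => /andP[_ /andP[/eqP ex _]].
by rewrite /le_rstar xeE eqxx /psi -mulrA ex eqxx.
Qed.

Lemma phi_mono x :
  {in rstar_seg x &, {mono @phi R : a b / le_rstar a b >-> le_proj a b}}.
Proof.
move=> a b /phiK xa /phiK xb; rewrite /phi /psi in xa xb *.
have [aP bP] := (dprime_proj a, dprime_proj b).
rewrite le_projE // /le_rstar; apply/eqP/andP => [ab|[_ /eqP ab]].
  split; last by apply/eqP/esym/(mul_dprime_id a).
  by rewrite -{1}xb -mulrA (proj_mulC_id _ _ aP bP ab) xa.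
exact/(mul_dprime_id a)/esym.
Qed.

End DoublePrime.

Theorem theorem4p2 (R : rickartStarRingType) (x : R) :
  [/\ {in rstar_seg x, forall a, phi a \in proj_seg (dprime x)},
      {in proj_seg (dprime x), forall e, psi x e \in rstar_seg x},
      {in rstar_seg x, cancel (@phi R) (psi x)},
      {in proj_seg (dprime x), cancel (psi x) (@phi R)} &
      {in rstar_seg x &, {mono @phi R : a b / le_rstar a b >-> le_proj a b}}
      /\ {in proj_seg (dprime x) &,
           {mono psi x : e f / le_proj e f >-> le_rstar e f}}].
Proof.
split; [exact: phi_seg | exact: psi_seg | exact: phiK | exact: psiK |].
split=> [|e f eS fS]; first exact: phi_mono.
(* Monotonicity of the inverse is carried over from [phi], applied to [x e] and [x f]. *)
by rewrite -(phi_mono _ x) ?psi_seg // !(psiK _ x).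
Qed.
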